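(* Let $3<q<r$ be odd primes and write $\Psi_{3qr}(x)=\sum_k c_{3qr}(k)x^k$. (1) If $q\equiv 1\pmod 3$, $r\equiv 1\pmod 3$ and $r\le 2q-7$, then $V_{3qr}=\{-2,-1,0,1,2\}$; in particular $c_{3qr}(r+1)=2$ and $c_{3qr}(r+1+qr)=-2$. (2) If $q\equiv 2\pmod 3$, $r\equiv 2\pmod 3$ and $r\le 2q-3$, then $V_{3qr}=\{-2,-1,0,1,2\}$; in particular $c_{3qr}(r)=-2$ and $c_{3qr}(r+qr)=2$. (3) In all remaining cases $V_{3qr}=\{-1,0,1\}$, so that $\Psi_{3qr}(x)$ is flat.
   Context: $\Phi_n(x)$ is the $n$-th cyclotomic polynomial, $\varphi$ is Euler's totient function, and $\Psi_n(x)=(x^n-1)/\Phi_n(x)=\sum_{k=0}^{n-\varphi(n)}c_n(k)x^k\in\mathbb Z[x]$. $V_n=\{c_n(k):0\le k\le n-\varphi(n)\}$. A polynomial in $\mathbb Z[x]$ is flat if the maximum absolute value of its coefficients equals $1$. *)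

(* Defs.v *)
From mathcomp Require Import all_boot all_order all_algebra all_field.

Set Implicit Arguments.
Unset Strict Implicit.
Unset Printing Implicit Defensive.

Import GRing.Theory.

Local Open Scope ring_scope.

(* For n = 0 the library sets 'Phi_0 = 1; only n > 0 is meaningful. *)
Definition inv_cyclotomic (n : nat) : {poly int} := ('X^n - 1) %/ 'Phi_n.

Notation "''Psi_' n" := (inv_cyclotomic n)
  (at level 8, n at level 2, format "''Psi_' n") : ring_scope.

(* The pseudo-division %/ over int is exact here: 'Phi_n is monic and
   divides 'X^n - 1. *)
Lemma inv_cyclotomicM (n : nat) :
  (0 < n)%N -> 'Psi_n * 'Phi_n = 'X^n - 1.
Proof.
move=> n_gt0; rewrite /inv_cyclotomic -(prod_Cyclotomic n_gt0).
rewrite (big_rem n) -?dvdn_divisors //= mulrC; congr (_ * _).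
by rewrite mulrC Pdiv.IdomainMonic.mulpK ?Cyclotomic_monic.
Qed.

Definition inv_cyclotomic_coef (n k : nat) : int := 'Psi_n`_k.

(* The set V_n, listed with repetitions: compare with =i, not with =. *)
Definition inv_cyclotomic_coefs (n : nat) : seq int :=
  [seq inv_cyclotomic_coef n k | k <- iota 0 (n - totient n).+1].

Definition flat_poly (p : {poly int}) : Prop :=
  (\max_(i < size p) `|(p`_i)%R|)%N = 1%N.

(* Main.v *)
Require Import Defs.
From mathcomp Require Import all_boot all_order all_algebra all_field.
From mathcomp Require Import zify ring.

(* Grouping the cyclotomic factors of x^(3qr) - 1 gives
   Psi_3qr = (x^(qr) - 1) f with f = (1 + x^r + x^(2r)) Phi_3q, and
   deg f = 2r + 2q - 2 < qr, so the coefficients of Psi_3qr are those of f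
   and their opposites. As 2r > 2q - 2 = deg Phi_3q, at most two of the three
   shifted copies of Phi_3q overlap at any degree. Since
   (1 + x + x^2) Phi_3q = 1 + x^q + x^(2q), the coefficient of Phi_3q at k < 2q
   is chi(k) + [q <= k] chi(k - q), where chi has period 3 and values 1, -1, 0.
   Overlapping coefficients thus add up to
   chi(j) + chi(j + r) + chi(j + r - q), which depends only on j, q, r mod 3;
   an overlap exists only for r <= 2q - 2, which parity and residues
   mod 3 sharpen to r <= 2q - 7 or r <= 2q - 3. *)

Local Open Scope ring_scope.
Import Order.TTheory GRing.Theory Num.Theory.

(** * Products of cyclotomic polynomials over divisors *)

Lemma perm_divisors_primeM (p n : nat) : prime p -> coprime p n -> (0 < n)%N ->
  perm_eq (divisors (p * n)) (divisors n ++ [seq (p * d)%N | d <- divisors n]).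
Proof.
move=> p_pr co_pn n_gt0; have p_gt0 := prime_gt0 p_pr.
apply: uniq_perm; first exact: divisors_uniq.
  rewrite cat_uniq divisors_uniq map_inj_uniq ?divisors_uniq; last first.
    by move=> d e /eqP; rewrite eqn_pmul2l // => /eqP.
  rewrite andbT; apply/hasPn => _ /mapP[d _ ->] /=; rewrite -dvdn_divisors //.
  apply/negP => /(dvdn_trans (dvdn_mulr d (dvdnn p))).
  by rewrite -[(_ %| _)%N]negbK -prime_coprime // co_pn.
move=> d; rewrite mem_cat -!dvdn_divisors ?muln_gt0 ?p_gt0 //.
apply/idP/orP => [d_dv | [d_dv | /mapP[e]]].
(* A divisor divisible by [p] is [p] times a divisor of [n]; any other is coprime to [p], hence
   divides [n]. *)
- have [p_dv | p_ndv] := boolP (p %| d)%N.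
    right; apply/mapP; exists (d %/ p)%N; last by rewrite mulnC divnK.
    by rewrite -dvdn_divisors // -(dvdn_pmul2l p_gt0) mulnC divnK.
  by left; rewrite -(@Gauss_dvdr _ p) // coprime_sym prime_coprime.
- exact: dvdn_mull.
- by rewrite -dvdn_divisors // => e_dv ->; rewrite dvdn_pmul2l.
Qed.

Lemma polyXn_sub1_neq0 (n : nat) : (0 < n)%N -> 'X^n - 1 != 0 :> {poly int}.
Proof. by move=> n_gt0; rewrite -size_poly_gt0 size_XnsubC. Qed.

(** Multiplied by x^n - 1, the product of the Phi_d over d | n, both sides become x^(3n) - 1. *)
Lemma prod_Cyclotomic_3M (n : nat) : coprime 3 n -> (0 < n)%N ->
  \prod_(d <- divisors n) 'Phi_(3 * d) = 1 + 'X^n + 'X^(2 * n).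
Proof.
move=> co_3n n_gt0; apply: (mulfI (polyXn_sub1_neq0 _ n_gt0)).
rewrite -{1}prod_Cyclotomic // -[X in _ * X](big_map (muln 3) predT Cyclotomic).
rewrite -big_cat -(perm_big _ (perm_divisors_primeM _ _ _ _ _)) //=.
by rewrite prod_Cyclotomic ?muln_gt0 // mulnC exprM mulnC exprM; ring.
Qed.

Lemma perm_divisors_prime (p : nat) : prime p -> perm_eq (divisors p) [:: 1; p]%N.
Proof.
move=> p_pr; have := @perm_divisors_primeM p 1 p_pr (coprimen1 p) isT.
by rewrite /= muln1.
Qed.

Lemma perm_divisors_prime2 (p q : nat) : prime p -> prime q -> p != q ->
  perm_eq (divisors (p * q)) [:: 1; q; p; p * q]%N.
Proof.
move=> p_pr q_pr neq_pq; have q_gt0 := prime_gt0 q_pr.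
apply: perm_trans (perm_divisors_primeM _ _ p_pr _ q_gt0) _.
  by rewrite prime_coprime // dvdn_prime2.
have pD := perm_divisors_prime _ q_pr.
by apply: perm_trans (perm_cat pD (perm_map _ pD)) _; rewrite /= muln1.
Qed.

(** * Division by 1 + x + x^2 *)

(* The coefficients of (1 - x) / (1 - x^3) = 1 / (1 + x + x^2). *)
Definition chi3 (k : nat) : int := nth 0 [:: 1; -1; 0] (k %% 3).

Lemma chi3_rec (k : nat) : chi3 k.+2 = - chi3 k.+1 - chi3 k.
Proof.
rewrite /chi3 -[k.+2]addn2 -[k.+1]addn1 -(modnDml k 2) -(modnDml k 1).
by have := ltn_pmod k (isT : 0 < 3)%N; case: (k %% 3)%N => [|[|[|]]].
Qed.

(** Used with [n = 1] for the recurrence on the coefficients of Phi_3q, and with [n = r] for the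
    cofactor f. *)
Lemma coefMXnD (p : {poly int}) (n k : nat) :
  ((1 + 'X^n + 'X^(2 * n)) * p)`_k =
    p`_k + (if (n <= k)%N then p`_(k - n) else 0)
    + (if (2 * n <= k)%N then p`_(k - 2 * n) else 0).
Proof. by rewrite !mulrDl mul1r !coefD !coefXnM !ltnNge !if_neg. Qed.

(** The hypothesis is (1 + x + x^2) b = 1 + x^q + x^(2q) read coefficientwise; it determines [b] by
    recursion, and x^(2q) does not act below degree 2q. *)
Lemma chi3_sum_unique (q : nat) (b : nat -> int) (q_gt1 : (1 < q)%N) :
    (forall j, b j + (if (1 <= j)%N then b (j - 1)%N else 0)
      + (if (2 <= j)%N then b (j - 2)%N else 0)
      = (j == 0)%:R + (j == q)%:R + (j == (2 * q)%N)%:R) ->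
  forall k, (k < 2 * q)%N -> b k = chi3 k + (if (q <= k)%N then chi3 (k - q) else 0).
Proof.
move=> rec k.
have [m] := ubnP k; elim: m k => // m IHm [|[|k]] lt_km lt_k2q.
- have := rec 0%N; rewrite /= !addr0 => ->.
  have [-> -> ->] : [/\ (q <= 0) = false, (0 == q) = false & (0 == 2 * q) = false]%N.
    by split; lia.
  by rewrite !addr0.
- have := rec 1%N; rewrite /= subnn (IHm 0%N) //; last by lia.
  have [-> -> ->] : [/\ (q <= 0) = false, (1 == q) = false & (1 == 2 * q) = false]%N.
    by split; lia.
  rewrite leqNgt q_gt1 !addr0 => /eqP.
  by rewrite addr_eq0 => /eqP.
have := rec k.+2; rewrite /= !subSS !subn0 (IHm k.+1) 1?(IHm k); try lia.
rewrite (ltn_eqF lt_k2q) /= add0r addr0 (chi3_rec k) => H.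
have {H} -> : b k.+2 = (k.+2 == q)%:R
    - (chi3 k.+1 + (if (q <= k.+1)%N then chi3 (k.+1 - q) else 0))
    - (chi3 k + (if (q <= k)%N then chi3 (k - q) else 0)) by rewrite -H; ring.
case: (ltngtP k.+2 q) => [lt_kq | lt_qk | eq_kq].
- have [-> ->] : (q <= k.+1)%N = false /\ (q <= k)%N = false by lia.
  by rewrite mulr0n; ring.
(* Just after q the shifted copy has a single earlier term, so [chi3_rec] does not apply to it. *)
- have [eq_qk | neq_qk] := eqVneq q k.+1.
    rewrite eq_qk leqnn ltnn subnn subSnn /=.
    by rewrite (_ : chi3 0 = 1) // (_ : chi3 1 = -1) //; ring.
  have le_qk : (q <= k)%N by lia.
  rewrite le_qk (leqW le_qk) !subSn ?(leqW le_qk) // chi3_rec mulr0n; ring.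
- have [-> ->] : (q <= k.+1)%N = false /\ (q <= k)%N = false by lia.
  by rewrite eq_kq subnn (_ : chi3 0 = 1) // mulr1n; ring.
Qed.

Lemma modn3P (k : nat) : [\/ k %% 3 = 0, k %% 3 = 1 | k %% 3 = 2]%N.
Proof.
have := ltn_pmod k (isT : 0 < 3)%N.
by case: (k %% 3)%N => [|[|[|]]]; [constructor 1 | constructor 2 | constructor 3|].
Qed.

Lemma chi3D (m n : nat) : chi3 (m + n) = chi3 (m %% 3 + n %% 3).
Proof. by rewrite /chi3 modnDm. Qed.

Lemma chi3_bound (k : nat) : -1 <= chi3 k <= 1.
Proof. by rewrite /chi3; case: (modn3P k) => ->. Qed.

Section Main.

Variables q r : nat.
Hypotheses (prime_q : prime q) (prime_r : prime r).
Hypotheses (lt_3_q : (3 < q)%N) (lt_q_r : (q < r)%N).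

Let co3q : coprime 3 q.
Proof. by rewrite prime_coprime // dvdn_prime2 // neq_ltn lt_3_q. Qed.
Let co3r : coprime 3 r.
Proof. by rewrite prime_coprime // dvdn_prime2 // neq_ltn (ltn_trans lt_3_q). Qed.
Let coqr : coprime q r.
Proof. by rewrite prime_coprime // dvdn_prime2 // neq_ltn lt_q_r. Qed.

(** * Factorisation of Psi_3qr *)

Lemma Cyclotomic_3M_prime : (1 + 'X^1 + 'X^(2 * 1)) * 'Phi_(3 * q) = 1 + 'X^q + 'X^(2 * q).
Proof.
rewrite -(prod_Cyclotomic_3M 1) // -(prod_Cyclotomic_3M q) ?prime_gt0 //.
by rewrite (perm_big _ (perm_divisors_prime _ prime_q)) /= !big_cons !big_nil !mulr1.
Qed.

(** After multiplication by Phi_3qr, this is (x^(3qr) - 1) / (x^(qr) - 1) = Phi_3 Phi_3q Phi_3r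
    Phi_3qr, where Phi_3 Phi_3r = 1 + x^r + x^(2r). *)
Lemma inv_cyclotomic_3MM :
  'Psi_(3 * q * r) = ('X^(q * r) - 1) * ((1 + 'X^r + 'X^(2 * r)) * 'Phi_(3 * q)).
Proof.
have [q_gt0 r_gt0] : (0 < q)%N /\ (0 < r)%N by rewrite !prime_gt0.
have Phi_neq0 : 'Phi_(3 * q * r) != 0 by rewrite monic_neq0 ?Cyclotomic_monic.
apply: (mulIf Phi_neq0).
rewrite inv_cyclotomicM ?muln_gt0 ?q_gt0 //.
rewrite -(prod_Cyclotomic_3M r) // (perm_big _ (perm_divisors_prime _ prime_r)) /=.
have -> : 'X^(3 * q * r) - 1 =
    ('X^(q * r) - 1) * (1 + 'X^(q * r) + 'X^(2 * (q * r))) :> {poly int}.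
  by rewrite -mulnA [(3 * _)%N]mulnC [(2 * _)%N]mulnC !(exprM _ (q * r)); ring.
rewrite -prod_Cyclotomic_3M ?muln_gt0 ?q_gt0 ?coprimeMr ?co3q //.
rewrite (perm_big _ (perm_divisors_prime2 _ _ prime_q prime_r _)) /=; last first.
  by rewrite neq_ltn lt_q_r.
rewrite !big_cons !big_nil !mulr1 -[(3 * q * r)%N]mulnA.
by rewrite !mulrA; congr (_ * _); rewrite -!mulrA [_ * 'Phi_(3 * q)]mulrC.
Qed.

(** * Coefficients of Phi_3q *)

Lemma totient_3M : totient (3 * q) = (2 * (q - 1))%N.
Proof. by rewrite totient_coprime // !totient_prime // subn1. Qed.

Lemma coef_Cyclotomic_3M_large (k : nat) : (2 * q - 2 < k)%N -> ('Phi_(3 * q))`_k = 0.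
Proof.
move=> lt_k; rewrite nth_default // size_Cyclotomic totient_3M; lia.
Qed.

Lemma coef_Cyclotomic_3M (k : nat) : (k < 2 * q)%N ->
  ('Phi_(3 * q))`_k = chi3 k + (if (q <= k)%N then chi3 (k - q) else 0).
Proof.
move: k; apply: chi3_sum_unique => [|j]; first exact: ltn_trans lt_3_q.
by rewrite -(coefMXnD _ 1) Cyclotomic_3M_prime !coefD !coefXn coef1.
Qed.

Local Notation a k := (('Phi_(3 * q))`_k).

Let q_mod3 : (q %% 3 = 1 \/ q %% 3 = 2)%N.
Proof.
case: (modn3P q) => [q0||]; [|by left|by right].
by move: co3q; rewrite prime_coprime // /dvdn q0.
Qed.

Lemma coef_Cyclotomic_3M_bound (k : nat) : -1 <= a k <= 1.
Proof.
have [lt_k|le_k] := ltnP k (2 * q); last first.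
  by rewrite coef_Cyclotomic_3M_large //; lia.
rewrite /= coef_Cyclotomic_3M //; case: leqP => [le_qk | _]; last first.
  by rewrite addr0 chi3_bound.
(* The sum depends only on k - q and q mod 3; as 3 does not divide q, two equal nonzero values never
   meet. *)
rewrite -{1 3}(subnK le_qk) chi3D.
have -> : chi3 (k - q) = chi3 ((k - q) %% 3) by rewrite /chi3 modn_mod.
by case: (modn3P (k - q)) => ->; case: q_mod3 => ->.
Qed.

Lemma coef_Cyclotomic_3M_pair (j : nat) : (j + r <= 2 * q - 2)%N ->
  a j + a (j + r)%N = chi3 j + chi3 (j + r) + chi3 (j + (r - q)).
Proof.
move=> le_j; rewrite /= !coef_Cyclotomic_3M; try lia.
(* Since r > q, the bound on j + r forces j < q: the pair contributes one term and two terms. *)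
have [-> ->] : (q <= j)%N = false /\ (q <= j + r)%N by lia.
by rewrite addr0 addrA addnBA // ltnW.
Qed.

(** * Overlaps in the cofactor f *)

Local Notation f := ((1 + 'X^r + 'X^(2 * r)) * 'Phi_(3 * q)).

(** The witness is k reduced by 0, r or 2r, according to the last shifted copy that has started.
    From 2r on the unshifted copy has ended, so two copies at most remain. *)
Lemma coef_cofactor (k : nat) : exists j,
  f`_k = a j \/ (j + r <= 2 * q - 2)%N /\ f`_k = a j + a (j + r)%N.
Proof.
rewrite coefMXnD; have [lt_kr | le_rk] := ltnP k r.
  exists k; left; rewrite (_ : (2 * r <= k)%N = false) ?addr0 //; lia.
have [lt_k2r | le_2rk] := ltnP k (2 * r).
  exists (k - r)%N; rewrite subnK // addr0.
  have [le_k | lt_k] := leqP k (2 * q - 2); first by right; rewrite addrC.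
  by left; rewrite (coef_Cyclotomic_3M_large k) // add0r.
exists (k - 2 * r)%N; rewrite (coef_Cyclotomic_3M_large k) ?add0r; last by lia.
rewrite (_ : (k - r = k - 2 * r + r)%N); last by lia.
have [le_k | lt_k] := leqP (k - 2 * r + r) (2 * q - 2); first by right; rewrite addrC.
by left; rewrite (coef_Cyclotomic_3M_large (k - 2 * r + r)) // add0r.
Qed.

Lemma coef_cofactor_large (k : nat) : (q * r <= k)%N ->
  f`_k = 0.
Proof.
move=> le_k; have : (4 * r <= q * r)%N by rewrite leq_mul2r lt_3_q orbT.
move=> le_4r; rewrite coefMXnD !coef_Cyclotomic_3M_large; try lia.
by rewrite !if_same !addr0.
Qed.

(** * Coefficients of Psi_3qr *)

Lemma coef_inv_cyclotomic_3MM (k : nat) : inv_cyclotomic_coef (3 * q * r) k =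
  if (k < q * r)%N then - f`_k
  else f`_(k - q * r).
Proof.
rewrite /inv_cyclotomic_coef inv_cyclotomic_3MM mulrBl mul1r coefB coefXnM.
case: ltnP => [_ | le_k]; first by rewrite sub0r.
by rewrite (coef_cofactor_large _ le_k) subr0.
Qed.

Lemma inv_cyclotomic_coef_bound (n : int) :
    (forall k, - n <= f`_k <= n) ->
  forall k, - n <= inv_cyclotomic_coef (3 * q * r) k <= n.
Proof.
move=> f_bound k; rewrite coef_inv_cyclotomic_3MM; case: ifP => _ //.
by rewrite lerN2 lerNl andbC.
Qed.

(** The last index, 3qr - 2(q - 1)(r - 1) = qr + 2q + 2r - 2, lies beyond every index at which a
    value is exhibited. *)
Lemma mem_inv_cyclotomic_coefs (k : nat) : (k <= r + 1 + q * r)%N ->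
  inv_cyclotomic_coef (3 * q * r) k \in inv_cyclotomic_coefs (3 * q * r).
Proof.
move=> le_k; apply/mapP; exists k => //.
rewrite mem_iota add0n /= ltnS totient_coprime ?coprimeMl ?co3r ?coqr //.
rewrite totient_3M totient_prime // (leq_trans le_k) //.
case: q r lt_3_q lt_q_r => // q' [] // r' ? ?; rewrite subn1 /=; nia.
Qed.

Lemma inv_cyclotomic_coefsP (x : int) : x \in inv_cyclotomic_coefs (3 * q * r) ->
  exists k, x = inv_cyclotomic_coef (3 * q * r) k.
Proof. by case/mapP=> k _ ->; exists k. Qed.

Lemma inv_cyclotomic_coef_small :
  [/\ inv_cyclotomic_coef (3 * q * r) 0 = -1, inv_cyclotomic_coef (3 * q * r) 1 = 1
    & inv_cyclotomic_coef (3 * q * r) 2 = 0].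
Proof.
have lt_qr k : (k < r -> k < q * r)%N by nia.
have small k : (k < q -> inv_cyclotomic_coef (3 * q * r) k = - chi3 k)%N.
  move=> lt_k; rewrite coef_inv_cyclotomic_3MM coefMXnD lt_qr; last by lia.
  rewrite coef_Cyclotomic_3M; last by lia.
  have [-> -> ->] : [/\ (q <= k) = false, (r <= k) = false & (2 * r <= k) = false]%N.
    by split; lia.
  by rewrite !addr0.
by split; rewrite small ?(ltn_trans _ lt_3_q).
Qed.

(** * Extreme coefficients of f *)

Lemma coef_cofactor_pair (j : nat) : (j <= 1)%N -> (j + r <= 2 * q - 2)%N ->
  f`_(j + r)
    = chi3 j + chi3 (j + r) + chi3 (j + (r - q)).
Proof.
move=> j_le1 le_j; rewrite coefMXnD leq_addl addnK.
rewrite (_ : (2 * r <= j + r)%N = false) ?addr0; last by lia.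
by rewrite -coef_Cyclotomic_3M_pair // addrC.
Qed.

Lemma coef_cofactor_bound2 (k : nat) : -2 <= f`_k <= 2.
Proof.
have [j [-> | [_ ->]]] := coef_cofactor k.
  by move: (coef_Cyclotomic_3M_bound j); lia.
by move: (coef_Cyclotomic_3M_bound j) (coef_Cyclotomic_3M_bound (j + r)); lia.
Qed.

Lemma coef_cofactor_bound1 :
    ~ [/\ (q = 1 %[mod 3])%N, (r = 1 %[mod 3])%N & (r <= 2 * q - 7)%N] ->
    ~ [/\ (q = 2 %[mod 3])%N, (r = 2 %[mod 3])%N & (r <= 2 * q - 3)%N] ->
  forall k, -1 <= f`_k <= 1.
Proof.
move=> not1 not2 k; have [j [-> | [le_j ->]]] := coef_cofactor k.
  exact: coef_Cyclotomic_3M_bound.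
have odd_p p : prime p -> (3 < p)%N -> odd p by move/even_prime=> [->|].
have odd_q := odd_p q prime_q lt_3_q.
have odd_r := odd_p r prime_r (ltn_trans lt_3_q lt_q_r).
have r_neq0 : (r %% 3 != 0)%N by move: co3r; rewrite prime_coprime.
rewrite coef_Cyclotomic_3M_pair // -[chi3 j]/(nth 0 _ (j %% 3)).
rewrite (chi3D j r) (chi3D j (r - q)).
have [q1 | q2] := q_mod3.
  (* If r = 1 mod 3, the overlap makes 2q - r odd, at least 2 and 1 mod 3, hence at least 7, against
     [not1]. *)
  have r2 : (r %% 3 = 2)%N by apply/eqP; apply: contraT => r_neq; case: not1; split; lia.
  have -> : ((r - q) %% 3 = 1)%N by lia.
  (* Now j, j + r and j + r - q cover all residues mod 3, so the three values sum to 0; likewise in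
     the other case. *)
  by rewrite r2; case: (modn3P j) => ->.
have r1 : (r %% 3 = 1)%N by apply/eqP; apply: contraT => r_neq; case: not2; split; lia.
have -> : ((r - q) %% 3 = 2)%N by lia.
by rewrite r1; case: (modn3P j) => ->.
Qed.

(** One coefficient of f yields both 2 and -2, since it occurs negated at [k] and unchanged at
    [k + q * r]; indices 0, 1, 2 supply the values -1, 1, 0. *)
Lemma inv_cyclotomic_coefs2 (k : nat) : (k <= r + 1)%N -> `|f`_k| = 2 ->
  inv_cyclotomic_coefs (3 * q * r) =i [:: -2; -1; 0; 1; 2].
Proof.
move=> le_k f_k x; have lt_qr : (k < q * r)%N by nia.
have c_k : inv_cyclotomic_coef (3 * q * r) k = - f`_k.
  by rewrite coef_inv_cyclotomic_3MM lt_qr.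
have c_kD : inv_cyclotomic_coef (3 * q * r) (k + q * r) = f`_k.
  by rewrite coef_inv_cyclotomic_3MM addnK ltnNge leq_addl.
apply/idP/idP => [/inv_cyclotomic_coefsP[i ->] | ].
  have := inv_cyclotomic_coef_bound _ coef_cofactor_bound2 i.
  by rewrite !inE; lia.
have mem_k := mem_inv_cyclotomic_coefs k (leq_trans le_k (leq_addr _ _)).
have := mem_inv_cyclotomic_coefs (k + q * r); rewrite leq_add2r => /(_ le_k).
move: mem_k; rewrite c_k c_kD.
have [c0 c1 c2] := inv_cyclotomic_coef_small.
have := mem_inv_cyclotomic_coefs 0; rewrite c0 => /(_ isT).
have := mem_inv_cyclotomic_coefs 1; rewrite c1 -addnA addnCA => /(_ isT).
have := mem_inv_cyclotomic_coefs 2; rewrite c2.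
have -> : (2 <= r + 1 + q * r)%N by lia.
move=> /(_ isT) m0 m1 mN1 mNf mf; rewrite !inE.
have [f2 | f2] : f`_k = 2 \/ f`_k = -2 by lia.
  by rewrite f2 in mf mNf; do 4![case/orP=> [/eqP->|] //]; move/eqP->.
by rewrite f2 opprK in mf mNf; do 4![case/orP=> [/eqP->|] //]; move/eqP->.
Qed.

End Main.

Theorem theorem5 (q r : nat) (prime_q : prime q) (prime_r : prime r)
    (lt_3_q : (3 < q)%N) (lt_q_r : (q < r)%N) :
  [/\ (* (1) *)
      (q = 1 %[mod 3])%N -> (r = 1 %[mod 3])%N -> (r <= 2 * q - 7)%N ->
      [/\ inv_cyclotomic_coefs (3 * q * r) =i [:: -2; -1; 0; 1; 2],
          inv_cyclotomic_coef (3 * q * r) (r + 1) = 2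
        & inv_cyclotomic_coef (3 * q * r) (r + 1 + q * r) = -2],
      (* (2) *)
      (q = 2 %[mod 3])%N -> (r = 2 %[mod 3])%N -> (r <= 2 * q - 3)%N ->
      [/\ inv_cyclotomic_coefs (3 * q * r) =i [:: -2; -1; 0; 1; 2],
          inv_cyclotomic_coef (3 * q * r) r = -2
        & inv_cyclotomic_coef (3 * q * r) (r + q * r) = 2]
    & (* (3) *)
      ~ [/\ (q = 1 %[mod 3])%N, (r = 1 %[mod 3])%N & (r <= 2 * q - 7)%N] ->
      ~ [/\ (q = 2 %[mod 3])%N, (r = 2 %[mod 3])%N & (r <= 2 * q - 3)%N] ->
      inv_cyclotomic_coefs (3 * q * r) =i [:: -1; 0; 1] /\
      flat_poly 'Psi_(3 * q * r)].
Proof.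
have bound k : (k <= 1)%N -> (k + r <= r + 1)%N by rewrite addnC leq_add2l.
have lt_qr k : (k <= 1)%N -> (k + r < q * r)%N by nia.
(* The residues are explicit so that the sum evaluates once those of [r] and [r - q] are known. *)
have pair_coefs k v : (k <= 1)%N -> (k + r <= 2 * q - 2)%N ->
    chi3 (k %% 3) + chi3 (k %% 3 + r %% 3) + chi3 (k %% 3 + (r - q) %% 3) = v -> `|v| = 2 ->
    [/\ inv_cyclotomic_coefs (3 * q * r) =i [:: -2; -1; 0; 1; 2],
        inv_cyclotomic_coef (3 * q * r) (k + r) = - v
      & inv_cyclotomic_coef (3 * q * r) (k + r + q * r) = v].
  move=> le_k1 le_k; rewrite -!chi3D modn_small ?(leq_ltn_trans le_k1) //.
  rewrite -coef_cofactor_pair // => f_v v2; split.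
  - by apply: (@inv_cyclotomic_coefs2 q r _ _ _ _ (k + r)); rewrite ?f_v ?bound.
  - by rewrite coef_inv_cyclotomic_3MM // lt_qr // f_v.
  - by rewrite coef_inv_cyclotomic_3MM // addnK ltnNge leq_addl f_v.
split=> [q1 r1 le_r | q2 r2 le_r | not1 not2].
- have s0 : ((r - q) %% 3 = 0)%N by lia.
  (* [chi3 1 + chi3 2 + chi3 1 = -2]. *)
  have [] := pair_coefs 1%N (-2) isT; rewrite ?r1 ?s0 //; first by lia.
  by rewrite addnC.
- have s0 : ((r - q) %% 3 = 0)%N by lia.
  (* [chi3 0 + chi3 2 + chi3 0 = 2]. *)
  have [] := pair_coefs 0%N 2 isT; rewrite ?r2 ?s0 //; lia.
have c_bound := inv_cyclotomic_coef_bound _ _ prime_q prime_r lt_3_q lt_q_r 1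
  (coef_cofactor_bound1 _ _ prime_q prime_r lt_3_q lt_q_r not1 not2).
have [c0 c1 c2] := inv_cyclotomic_coef_small _ _ prime_q prime_r lt_3_q lt_q_r.
have c_mem := mem_inv_cyclotomic_coefs _ _ prime_q prime_r lt_3_q lt_q_r.
split.
  move=> x; apply/idP/idP => [/inv_cyclotomic_coefsP[i ->] | ].
    by have := c_bound i; rewrite !inE; lia.
  have := c_mem 2; have := c_mem 1%N; have := c_mem 0; rewrite c0 c1 c2.
  move=> /(_ isT) mN1 m1 m0; rewrite !inE.
  by case/or3P=> /eqP-> //; [apply: m0 | apply: m1]; lia.
have size_gt0 : (0 < size 'Psi_(3 * q * r))%N.
  by rewrite size_poly_gt0; apply/eqP => p0; move: c0; rewrite /inv_cyclotomic_coef p0 coef0.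
apply/eqP; rewrite eqn_leq; apply/andP; split.
  apply/bigmax_leqP => i _; have := c_bound i; rewrite /inv_cyclotomic_coef; lia.
(* The constant coefficient -1 attains the maximum. *)
apply: leq_trans (leq_bigmax (Ordinal size_gt0)) => /=.
by move: c0; rewrite /inv_cyclotomic_coef => ->.
Qed.
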